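(* For the DAG $M_{m_1,m_2,m_3}$ of standard matrix multiplication of an $m_1\times m_2$ matrix by an $m_2\times m_3$ matrix, we have $$\mathrm{OPT}_{PRBP}(M_{m_1,m_2,m_3},r)\ \ge\ \Omega\!\left(\frac{m_1\cdot m_2\cdot m_3}{\sqrt r}\right),$$ i.e. there is an absolute constant $c>0$ such that $\mathrm{OPT}_{PRBP}(M_{m_1,m_2,m_3},r)\ge c\cdot\frac{m_1m_2m_3}{\sqrt r}$ for all positive integers $m_1,m_2,m_3$ and every integer $r\ge 2$.
   Context: Standard matrix multiplication DAG $M_{m_1,m_2,m_3}$: its sources are nodes $a_{i,l}$ ($i\in[m_1]$, $l\in[m_2]$) and $b_{l,j}$ ($l\in[m_2]$, $j\in[m_3]$); its internal nodes are $p_{i,l,j}$ with the two incoming edges from $a_{i,l}$ and $b_{l,j}$; its sinks are $c_{i,j}$ ($i\in[m_1]$, $j\in[m_3]$) with incoming edges from $p_{i,1,j},\dots,p_{i,m_2,j}$. Here $[k]=\{1,\dots,k\}$. Partial-computing red-blue pebble game (PRBP, one-shot) on a finite DAG $G=(V,E)$ with fast memory capacity $r$. Sources are nodes of in-degree 0, sinks are nodes of out-degree 0. There are blue, light red and dark red pebbles, and edges can be marked. Initially exactly the sources carry blue pebbles, there are no other pebbles, and all edges are unmarked. Moves: (1) Save: replace a dark red pebble on a node by a blue and a light red pebble. (2) Load: place a light red pebble on a node that has a blue pebble. (3) Partial compute: for an unmarked edge $(u,v)$ such that (i) all incoming edges of $u$ are marked, (ii) $u$ has a (light or dark) red pebble,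 and (iii) $v$ has a (light or dark) red pebble or no pebble at all, replace all pebbles on $v$ by one dark red pebble and mark $(u,v)$ (each edge is marked at most once and never unmarked). (4) Delete: remove a light red pebble from any node, or remove a dark red pebble from a non-sink node all of whose outgoing edges are marked. At every time the total number of (light and dark) red pebbles is at most $r$. A pebbling is a sequence of moves after which every sink has a blue pebble and every edge is marked. Its cost is the total number of save and load moves, and $\mathrm{OPT}_{PRBP}(G,r)$ is the minimum cost of a pebbling of $G$ with capacity $r$. *)

(* Defs.v *)
From HB Require Import structures.
From mathcomp Require Import all_boot all_order all_algebra.
From mathcomp Require Import boolp reals.

Set Implicit Arguments.
Unset Strict Implicit.
Unset Printing Implicit Defensive.

Record dag := Dag {
  node :> finType;
  edge : rel node;
  dag_acyclic : forall x y : node, edge x y -> ~~ connect edge y x }.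

Definition is_source (G : dag) (v : G) : bool := [forall u, ~~ edge u v].
Definition is_sink (G : dag) (v : G) : bool := [forall w, ~~ edge v w].

Record state (G : dag) := State {
  blue : {set G};
  light : {set G};
  dark : {set G};
  marked : {set G * G} }.

Definition red (G : dag) (s : state G) : {set G} := light s :|: dark s.

(* Counts pebbles, not nodes. *)
Definition num_red (G : dag) (s : state G) : nat := #|light s| + #|dark s|.

Definition all_in_marked (G : dag) (s : state G) (v : G) : bool :=
  [forall u, edge u v ==> ((u, v) \in marked s)].
Definition all_out_marked (G : dag) (s : state G) (v : G) : bool :=
  [forall w, edge v w ==> ((v, w) \in marked s)].

Inductive move (G : dag) :=
  | SaveNode of G
  | LoadNode of G
  | ComputeEdge of G & G
  | DeleteLight of G
  | DeleteDark of G.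

Definition legal (G : dag) (s : state G) (m : move G) : bool :=
  match m with
  | SaveNode v => v \in dark s
  | LoadNode v => v \in blue s
  | ComputeEdge u v =>
      [&& edge u v, (u, v) \notin marked s, all_in_marked s u, u \in red s
        & (v \in red s) || (v \notin blue s :|: red s)]
  | DeleteLight v => v \in light s
  | DeleteDark v => [&& v \in dark s, ~~ is_sink v & all_out_marked s v]
  end.

Definition apply_move (G : dag) (s : state G) (m : move G) : state G :=
  match m with
  | SaveNode v => State (v |: blue s) (v |: light s) (dark s :\ v) (marked s)
  | LoadNode v => State (blue s) (v |: light s) (dark s) (marked s)
  | ComputeEdge u v =>
      State (blue s :\ v) (light s :\ v) (v |: dark s) ((u, v) |: marked s)
  | DeleteLight v => State (blue s) (light s :\ v) (dark s) (marked s)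
  | DeleteDark v => State (blue s) (light s) (dark s :\ v) (marked s)
  end.

Definition initial (G : dag) : state G :=
  State [set v | is_source v] set0 set0 set0.

Definition terminal (G : dag) (s : state G) : bool :=
  [forall v, is_sink v ==> (v \in blue s)]
  && [forall u, forall v, edge u v ==> ((u, v) \in marked s)].

Fixpoint valid_from (G : dag) (r : nat) (s : state G) (ms : seq (move G)) :=
  (num_red s <= r) &&
  match ms with
  | [::] => terminal s
  | m :: ms' => legal s m && valid_from r (apply_move s m) ms'
  end.

Definition pebbling (G : dag) (r : nat) (ms : seq (move G)) : bool :=
  valid_from r (initial G) ms.

Definition is_io (G : dag) (m : move G) : bool :=
  match m with SaveNode _ | LoadNode _ => true | _ => false end.

Definition cost (G : dag) (ms : seq (move G)) : nat := count (@is_io G) ms.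

Definition is_cost (G : dag) (r k : nat) : Prop :=
  exists ms : seq (move G), pebbling r ms /\ cost ms = k.

(* The minimum of a set of naturals; the value 0 is a dummy for the case where
   no pebbling exists. *)
Definition OPT_PRBP (G : dag) (r : nat) : nat :=
  match pselect (exists k, `[< is_cost G r k >]) with
  | left h => ex_minn h
  | right _ => 0
  end.

Inductive mm_node (m1 m2 m3 : nat) :=
  | NodeA of 'I_m1 & 'I_m2
  | NodeB of 'I_m2 & 'I_m3
  | NodeP of 'I_m1 & 'I_m2 & 'I_m3
  | NodeC of 'I_m1 & 'I_m3.

Section MMNode.
Variables m1 m2 m3 : nat.
Notation T := (mm_node m1 m2 m3).

Definition mm_code (x : T) :
    ('I_m1 * 'I_m2) + ('I_m2 * 'I_m3) + ('I_m1 * 'I_m2 * 'I_m3)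
    + ('I_m1 * 'I_m3) :=
  match x with
  | NodeA i l => inl (inl (inl (i, l)))
  | NodeB l j => inl (inl (inr (l, j)))
  | NodeP i l j => inl (inr (i, l, j))
  | NodeC i j => inr (i, j)
  end.

Definition mm_decode (y : ('I_m1 * 'I_m2) + ('I_m2 * 'I_m3)
    + ('I_m1 * 'I_m2 * 'I_m3) + ('I_m1 * 'I_m3)) : T :=
  match y with
  | inl (inl (inl (i, l))) => NodeA m3 i l
  | inl (inl (inr (l, j))) => NodeB m1 l j
  | inl (inr (i, l, j)) => NodeP i l j
  | inr (i, j) => NodeC m2 i j
  end.

Lemma mm_codeK : cancel mm_code mm_decode.
Proof. by case. Qed.

HB.instance Definition _ := Finite.copy T (can_type mm_codeK).

Definition mm_edge : rel T := fun x y =>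
  match x, y with
  | NodeA i l, NodeP i' l' _ => (i == i') && (l == l')
  | NodeB l j, NodeP _ l' j' => (l == l') && (j == j')
  | NodeP i _ j, NodeC i' j' => (i == i') && (j == j')
  | _, _ => false
  end.

Definition mm_layer (x : T) : nat :=
  match x with
  | NodeA _ _ | NodeB _ _ => 0
  | NodeP _ _ _ => 1
  | NodeC _ _ => 2
  end.

Lemma mm_edge_layer x y : mm_edge x y -> mm_layer x < mm_layer y.
Proof. by case: x => [? ?|? ?|? ? ?|? ?]; case: y. Qed.

Lemma mm_acyclic x y : mm_edge x y -> ~~ connect mm_edge y x.
Proof.
move=> /mm_edge_layer xy; apply/negP => /connectP[p + xE].
suff le_last z q : path mm_edge z q -> mm_layer z <= mm_layer (last z q).
  by move=> /le_last; rewrite -xE leqNgt xy.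
elim: q z => //= w q IH z /andP[/mm_edge_layer zw /IH].
by apply: leq_trans; apply: ltnW.
Qed.

End MMNode.

(* The index set [k] = {1, ..., k} is represented by 'I_k = {0, ..., k - 1}. *)
Definition mm_dag (m1 m2 m3 : nat) : dag := Dag (@mm_acyclic m1 m2 m3).

(* Main.v *)
(** Cut a pebbling into phases of exactly r I/O moves (the last one shorter).
    During a phase at most 2r sources are ever red, and every node into which an
    edge is computed either is dark at the end of the phase, or was saved, or
    has all its outgoing edges marked.  So all but 2r of the nodes p_{i,l,j}
    first touched in a phase have all three of their edges marked within it;
    their (i,l), (l,j) and (i,j) lie in sets of size at most 2r, so by the
    Loomis-Whitney inequality there are at most (2r)^{3/2} of them.  If the
    whole pebbling has fewer than r I/O moves, one uses instead that every source
    must be loaded and every sink saved, whence (m1 m2 m3)^2 <= cost^3.  Since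
    OPT is 0 by convention when no pebbling exists, one also needs a pebbling
    for every r >= 2: treat one edge at a time, saving everything in between. *)
Require Import Defs.
From mathcomp Require Import all_boot all_order all_algebra.
From mathcomp Require Import boolp reals.
From mathcomp Require Import zify ring lra.
Import Order.TTheory GRing.Theory Num.Theory.

Set Implicit Arguments.
Unset Strict Implicit.
Unset Printing Implicit Defensive.

(** * Existence of a pebbling for every capacity at least 2 *)

Section Existence.
Variable G : dag.

Lemma edge_neq (u v : G) : edge u v -> u != v.
Proof. by move=> uv; apply/eqP => e; move: (dag_acyclic uv); rewrite e connect0. Qed.

Lemma ready_edge (M : {set G * G}) (u v : G) :
  edge u v -> (u, v) \notin M ->
  exists x y : G, [/\ edge x y, (x, y) \notin M
                    & [forall w, edge w x ==> ((w, x) \in M)]].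
Proof.
move=> uv uvM.
pose P (e : G * G) := edge e.1 e.2 && (e \notin M).
have Puv : P (u, v) by rewrite /P uv uvM.
(* An unmarked edge whose tail has the fewest ancestors is ready. *)
case: (arg_minnP (fun e : G * G => #|[set w | connect (@edge G) w e.1]|) Puv).
move=> [x y] /andP[/= xy xyM] min; exists x, y; split=> //.
apply/forallP => w; apply/implyP => wx; apply/negPn/negP => wxM.
have := min (w, x); rewrite /P /= wx wxM => /(_ isT); apply/negP; rewrite -ltnNge.
apply/proper_card/properP; split.
  by apply/subsetP => z; rewrite !inE => zw; apply: connect_trans zw (connect1 wx).
by exists x; rewrite inE ?connect0 //; apply: dag_acyclic.
Qed.

(** The resting state between two edges: every node holding a partial or complete value is blue,
    nothing is red. It is [initial] for [M = set0] and terminal once [M] contains all edges. *)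
Definition saved_state (M : {set G * G}) : state G :=
  State [set v | is_source v || [exists u, (u, v) \in M]] set0 set0 M.

(** If [v] already holds a partial value, its only pebble is blue, and computing into it is illegal
    until it is loaded. *)
Definition edge_moves (M : {set G * G}) (u v : G) : seq (move G) :=
  LoadNode u ::
  (if v \in blue (saved_state M) then [:: LoadNode v] else [::]) ++
  [:: ComputeEdge u v; SaveNode v; DeleteLight u; DeleteLight v].

Lemma valid_edge_moves r (M : {set G * G}) (u v : G) ms : 1 < r -> edge u v -> (u, v) \notin M ->
  [forall w, edge w u ==> ((w, u) \in M)] ->
  valid_from r (saved_state ((u, v) |: M)) ms ->
  valid_from r (saved_state M) (edge_moves M u v ++ ms).
Proof.
move=> r2 uv uvM uin val.
have neq := edge_neq uv.
have nvu : (v == u) = false by rewrite eq_sym (negbTE neq).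
have ublue : u \in blue (saved_state M).
  rewrite inE; case: (boolP (is_source u)) => //= /forallPn[w].
  rewrite negbK => wu; apply/existsP; exists w.
  by move/forallP/(_ w): uin; rewrite wu.
have card2 : #|[set u; v]| = 2 by rewrite cards2 neq.
(* Computing removes the blue pebble from [v]; the save restores it. *)
have fin : State (v |: (blue (saved_state M) :\ v)) set0 set0 ((u, v) |: M)
    = saved_state ((u, v) |: M).
  congr State; apply/setP => w; rewrite !inE.
  have -> : [exists u0, (u0, w) \in (u, v) |: M]
      = (w == v) || [exists u0, (u0, w) \in M].
    apply/existsP/orP.
      move=> [x]; rewrite !inE => /orP[/eqP[_ ->]|xM]; first by left; rewrite eqxx.
      by right; apply/existsP; exists x.
    case=> [/eqP ->|/existsP[x xM]]; first by exists u; rewrite !inE eqxx.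
    by exists x; rewrite !inE xM orbT.
  by case: eqP => //=; rewrite orbT.
have tail L : L = [set u] \/ L = [set u; v] -> L :\ v = [set u] /\ #|L| <= r.
  case=> ->; split; rewrite ?cards1 ?card2 ?(ltnW r2) //.
    by apply/setP => w; rewrite !inE; case: eqP => // ->; rewrite nvu.
  by apply/setP => w; rewrite !inE; case: (w =P v) => //= [->|]; rewrite ?nvu ?orbF.
(* [L] is the light set just before the computation: [v] is missing from it if it has no value yet,
   and has been loaded otherwise. *)
have main L : L = [set u] /\ v \notin blue (saved_state M) \/ L = [set u; v] ->
    valid_from r (State (blue (saved_state M)) L set0 M)
     ([:: ComputeEdge u v; SaveNode v; DeleteLight u; DeleteLight v] ++ ms).
  move=> HL; have [Lv Lr] : L :\ v = [set u] /\ #|L| <= r.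
    by apply: tail; case: HL => [[]|]; auto.
  have uL : u \in L by case: HL => [[-> _]|->]; rewrite !inE eqxx.
  have vL : (v \in L) || (v \notin blue (saved_state M) :|: L).
    case: HL => [[-> vb]|->]; last by rewrite !inE eqxx orbT.
    by rewrite in_setU negb_or vb !inE nvu.
  have e1 : v |: [set u] = [set u; v] by rewrite setUC.
  have e2 : (v |: set0) :\ v = set0 :> {set G}.
    by apply/setP => w; rewrite !inE; case: eqP.
  have e3 : [set u; v] :\ u = [set v].
    by apply/setP => w; rewrite !inE; case: eqP => //= ->; rewrite (negbTE neq).
  have e4 : [set v] :\ v = set0 by apply/setP => w; rewrite !inE; case: eqP.
  rewrite /= /num_red /red /= setU0 cards0 addn0 Lr uv uvM uL vL /all_in_marked /= uin /=.
  rewrite Lv e1 e2 e3 e4 fin !setU0 !cards1 card2 cards0 ?addn0 !inE !eqxx.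
  by rewrite ?orbT r2 (ltnW r2).
rewrite /edge_moves cat_cons /= {1}/num_red /= cards0 leq0n /= ublue.
have -> : u |: set0 = [set u] by rewrite setU0.
case: ifPn => vb; last by apply: main; left.
have r1 : num_red (State (blue (saved_state M)) [set u] set0 M) <= r.
  by rewrite /num_red /= cards0 cards1 ltnW.
rewrite [valid_from _ _ _]/= r1 vb /=.
by apply: main; right; rewrite setUC.
Qed.

Lemma pebbling_exists r : 1 < r -> exists ms : seq (move G), pebbling r ms.
Proof.
move=> r2.
suff IH n (M : {set G * G}) :
    #|[set e : G * G | edge e.1 e.2] :\: M| <= n ->
    exists ms, valid_from r (saved_state M) ms.
  have [ms val] := IH _ set0 (leqnn _); exists ms; move: val.
  rewrite /pebbling; have -> // : saved_state set0 = initial G.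
  congr State; apply/setP => v; rewrite !inE; case: is_source => //=.
  by apply/existsP => -[u]; rewrite inE.
elim: n M => [|n IH] M cM.
all: case: (boolP [forall u, forall v, edge u v ==> ((u, v) \in M)]) => full.
(* With all edges marked, each node is a source or the head of a marked edge, hence blue. *)
1,3: exists [::]; rewrite /= /num_red !cards0 /terminal full andbT /=.
1,2: apply/forallP => v; apply/implyP => _; rewrite inE.
1,2: case: (boolP (is_source v)) => //= /forallPn[u]; rewrite negbK => uv.
1,2: apply/existsP; exists u.
1,2: by move: full => /forallP/(_ u)/forallP/(_ v)/implyP; apply.
all: move: full => /forallPn[u /forallPn[v]]; rewrite negb_imply => /andP[uv uvM].
  move: cM; rewrite leqn0 cards_eq0 => /eqP/setP/(_ (u, v)).
  by rewrite !inE uvM uv.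
have [x [y [xy xyM xin]]] := ready_edge uv uvM.
have [|ms val] := IH ((x, y) |: M).
  rewrite -ltnS; apply: leq_trans cM; apply: proper_card; apply/properP; split.
    by apply: setDS; apply: subsetUr.
  by exists (x, y); rewrite !inE ?xyM ?xy ?eqxx.
by exists (edge_moves M x y ++ ms); apply: valid_edge_moves.
Qed.

End Existence.

(** * Marked edges and I/O within a segment of a pebbling *)

Section Runs.
Variable G : dag.
Implicit Types (s : state G) (ms : seq (move G)) (u v w : G).

Definition run s ms : state G := foldl (@apply_move G) s ms.

Fixpoint legal_run s ms : bool :=
  if ms is m :: ms' then legal s m && legal_run (apply_move s m) ms' else true.

Definition io_node (m : move G) : {set G} :=
  match m with SaveNode v | LoadNode v => [set v] | _ => set0 end.

Definition io_nodes ms : {set G} := \bigcup_(m <- ms) io_node m.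

Lemma io_nodes_cons m ms : io_nodes (m :: ms) = io_node m :|: io_nodes ms.
Proof. exact: big_cons. Qed.

Lemma card_io_nodes ms : #|io_nodes ms| <= cost ms.
Proof.
elim: ms => [|m ms IH]; first by rewrite /io_nodes big_nil cards0.
rewrite io_nodes_cons; apply: leq_trans (leq_card_setU _ _) _.
by apply: leq_add IH; case: m => *; rewrite ?cards1 ?cards0.
Qed.

Lemma valid_from_cat r s ms1 ms2 : valid_from r s (ms1 ++ ms2) ->
  legal_run s ms1 /\ valid_from r (run s ms1) ms2.
Proof.
elim: ms1 s => //= m ms1 IH s /andP[_ /andP[-> /IH[-> ?]]].
by split.
Qed.

Lemma valid_num_red r s ms : valid_from r s ms -> num_red s <= r.
Proof. by case: ms => [|? ?] /andP[]. Qed.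

Lemma valid_terminal r s ms : valid_from r s ms -> terminal (run s ms).
Proof. by elim: ms s => [|m ms IH] s /= /andP[_] // /andP[_ /IH]. Qed.

Lemma marked_apply s m : marked s \subset marked (apply_move s m).
Proof. by case: m => //= *; apply: subsetUr. Qed.

Lemma marked_run s ms : marked s \subset marked (run s ms).
Proof.
elim: ms s => //= m ms IH s.
exact: subset_trans (marked_apply s m) (IH _).
Qed.

Lemma newly_marked s m u v : legal s m -> (u, v) \notin marked s ->
  (u, v) \in marked (apply_move s m) -> m = ComputeEdge u v.
Proof.
case: m => [w|w|w x|w|w] //= _ uvM; rewrite ?(negbTE uvM) // !inE (negbTE uvM) orbF.
by move=> /eqP[-> ->].
Qed.

(** No computation puts a pebble on a source, so the red pebble that [u] has when the edge is marked
    stems from [s] or from an I/O move on [u]. *)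
Lemma source_used s ms u v : legal_run s ms -> is_source u ->
  (u, v) \notin marked s -> (u, v) \in marked (run s ms) ->
  u \in red s :|: io_nodes ms.
Proof.
move=> + su; elim: ms s => [|m ms IH] s /=; first by move=> _ /negbTE->.
move=> /andP[lm lms] uvM uvM'.
have [uv1|uv1] := boolP ((u, v) \in marked (apply_move s m)).
  have e := newly_marked lm uvM uv1; rewrite {}e /= in lm.
  by case/and5P: lm => _ _ _ ured _; rewrite inE ured.
move: (IH _ lms uv1 uvM'); rewrite io_nodes_cons !inE => /orP[|->]; last by rewrite !orbT.
case: m lm {lms uv1 uvM' IH} => [w|w|w x|w|w] /=; rewrite /red !inE.
- by move=> _ /orP[/orP[]->|/andP[_ ->]]; rewrite ?orbT.
- by move=> _ /orP[/orP[]->|->]; rewrite ?orbT.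
- case/and5P=> wx _ _ _ _; have/negbTE-> : u != x.
    by apply: contraL wx => /eqP <-; move/forallP: su; apply.
  by rewrite /= => ->.
- by move=> _ /orP[/andP[_ ->]|->]; rewrite ?orbT.
- by move=> _ /orP[->|/andP[_ ->]]; rewrite ?orbT.
Qed.

Lemma all_out_marked_run s ms v :
  all_out_marked s v -> all_out_marked (run s ms) v.
Proof.
move=> /forallP H; apply/forallP => w; apply/implyP => vw.
by apply: (subsetP (marked_run s ms)); move: (H w); rewrite vw.
Qed.

(** A dark pebble vanishes only by a save, which is recorded in [io_nodes], or by a deletion, which
    requires a non-sink with all outgoing edges marked; marks persist. *)
Lemma dark_run s ms v : legal_run s ms -> v \in dark s ->
  (v \in dark (run s ms) :|: io_nodes ms)
  || (~~ is_sink v && all_out_marked (run s ms) v).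
Proof.
elim: ms s => [|m ms IH] s /=; first by move=> _ vd; rewrite inE vd.
move=> /andP[lm lms] vd.
have [vd1|vd1] := boolP (v \in dark (apply_move s m)).
  move: (IH _ lms vd1); rewrite io_nodes_cons !inE.
  by case/orP=> [/orP[]|] ->; rewrite ?orbT.
case: m lm lms vd1 {IH} => [w|w|w x|w|w] /=; rewrite ?vd // !inE vd ?orbT //= andbT negbK.
  by move=> _ _ /eqP<-; rewrite io_nodes_cons !inE eqxx orbT.
move=> /and3P[_ ns om] _ /eqP e; rewrite {}e ns.
have om1 : all_out_marked (apply_move s (DeleteDark w)) w by [].
by rewrite (all_out_marked_run ms om1) orbT.
Qed.

(** Marking the edge makes [v] dark; [dark_run] follows that pebble to the end of the segment. *)
Lemma head_marked s ms u v : legal_run s ms -> (u, v) \notin marked s ->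
  (u, v) \in marked (run s ms) ->
  (v \in dark (run s ms) :|: io_nodes ms)
  || (~~ is_sink v && all_out_marked (run s ms) v).
Proof.
elim: ms s => [|m ms IH] s /=; first by move=> _ /negbTE->.
move=> /andP[lm lms] uvM uvM'.
have [uv1|uv1] := boolP ((u, v) \in marked (apply_move s m)).
  have vd : v \in dark (apply_move s m).
    by rewrite (newly_marked lm uvM uv1) /= !inE eqxx.
  move: (dark_run lms vd); rewrite io_nodes_cons !inE.
  by case/orP=> [/orP[]|] ->; rewrite ?orbT.
move: (IH _ lms uv1 uvM'); rewrite io_nodes_cons !inE.
by case/orP=> [/orP[]|] ->; rewrite ?orbT.
Qed.

Lemma tail_marked s ms u v : legal_run s ms -> (u, v) \notin marked s ->
  (u, v) \in marked (run s ms) -> all_in_marked (run s ms) u.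
Proof.
elim: ms s => [|m ms IH] s /=; first by move=> _ /negbTE->.
move=> /andP[lm lms] uvM uvM'.
have [uv1|uv1] := boolP ((u, v) \in marked (apply_move s m)); last exact: IH uvM'.
have e := newly_marked lm uvM uv1.
have /forallP inu : all_in_marked s u by move: lm; rewrite e /= => /and5P[].
apply/forallP => w; apply/implyP => wu.
apply: (subsetP (marked_run _ ms)); apply: (subsetP (marked_apply s m)).
by move: (inu w); rewrite wu.
Qed.

(** Only a save creates a blue pebble. This forces an I/O move on every sink that is not blue at the
    start. *)
Lemma blue_run s ms : blue (run s ms) \subset blue s :|: io_nodes ms.
Proof.
elim: ms s => [|m ms IH] s /=; first exact: subsetUl.
apply: subset_trans (IH _) _; rewrite io_nodes_cons setUA setSU //.
by apply/subsetP => y; case: m => [w|w|w x|w|w]; rewrite /= !inE;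
  case: (y \in blue s); rewrite ?orbT ?orbF ?andbF.
Qed.

Lemma cost_cat ms1 ms2 : cost (ms1 ++ ms2) = cost ms1 + cost ms2.
Proof. exact: count_cat. Qed.

(** One move adds at most 1 to the cost, so the costs of prefixes skip no value. *)
Lemma split_cost k ms : k <= cost ms ->
  exists ms1 ms2, ms = ms1 ++ ms2 /\ cost ms1 = k.
Proof.
elim: ms k => [|m ms IH] k /=.
  by rewrite leqn0 => /eqP->; exists [::], [::].
case: k => [_|k kle]; first by exists [::], (m :: ms).
have [|ms1 [ms2 [-> e]]] := IH (k.+1 - is_io m).
  by rewrite leq_subLR.
exists (m :: ms1), ms2; split=> //; rewrite /cost /= -/(cost ms1) e.
by case: is_io; rewrite ?subn1 ?subn0.
Qed.

End Runs.

(** * The discrete Loomis-Whitney inequality in dimension three *)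

Section LoomisWhitney.

(** Cauchy-Schwarz against the constant 1: after doubling, each cross term is bounded by
    [f i ^ 2 + f j ^ 2]. *)
Lemma sum_sqr_le (I : finType) (C : {set I}) (f : I -> nat) :
  (\sum_(i in C) f i) ^ 2 <= #|C| * \sum_(i in C) f i ^ 2.
Proof.
rewrite -(leq_pmul2l (isT : 0 < 2)) -mulnn big_distrlr /= big_distrr /=.
have -> : 2 * (#|C| * \sum_(i in C) f i ^ 2)
    = \sum_(i in C) \sum_(j in C) (f i ^ 2 + f j ^ 2).
  rewrite [RHS](eq_bigr (fun i => #|C| * f i ^ 2 + \sum_(j in C) f j ^ 2)); last first.
    by move=> i _; rewrite big_split /= sum_nat_const.
  by rewrite big_split /= sum_nat_const -big_distrr /= mul2n addnn.
apply: leq_sum => i _; rewrite big_distrr /=; apply: leq_sum => j _.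
exact: nat_Cauchy.
Qed.

Lemma loomis_whitney (I L J : finType) (X : {set I * L * J})
    (A : {set I * L}) (B : {set L * J}) (C : {set I * J}) :
  (forall i l j, (i, l, j) \in X ->
     [/\ (i, l) \in A, (l, j) \in B & (i, j) \in C]) ->
  #|X| ^ 2 <= #|A| * #|B| * #|C|.
Proof.
move=> XABC.
pose f (c : I * J) := #|[set l | (c.1, l, c.2) \in X]|.
have cX : #|X| = \sum_(c in C) f c.
  rewrite -sum1_card (partition_big (fun t => (t.1.1, t.2)) [in C]) /=; last first.
    by move=> [[i l] j] /XABC[].
  apply: eq_bigr => -[i j] _; rewrite /f -(card_imset _ (f := fun l => (i, l, j))); last first.
    by move=> l l' [].
  rewrite -sum1_card; apply: eq_bigl => -[[i' l] j'] /=.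
  apply/andP/imsetP => [[tX /eqP[e1 e2]]|[l' + [-> -> ->]]].
    by subst i' j'; exists l; rewrite ?inE.
  by rewrite inE => tX; rewrite tX.
(* By Cauchy-Schwarz over the fibres of (i, l, j) |-> (i, j), it remains to
   inject the pairs (i, l, j), (i, l', j) of X into A * B by ((i, l), (l', j)). *)
rewrite cX mulnC; apply: leq_trans (sum_sqr_le C f) _; rewrite leq_mul2l.
apply/orP; right.
rewrite -cardsX.
pose D c := setX [set l | ((c : I * J).1, l, c.2) \in X] [set l | (c.1, l, c.2) \in X].
have -> : \sum_(c in C) f c ^ 2 = #|[set t : (I * J) * (L * L) | (t.1 \in C) && (t.2 \in D t.1)]|.
  rewrite -sum1_card (partition_big fst [in C]) /=; last by move=> t; rewrite inE => /andP[].
  apply: eq_bigr => c cC; rewrite -mulnn -cardsX -/(D c).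
  rewrite -(card_imset _ (f := fun ll => (c, ll))); last by move=> ? ? [].
  rewrite -sum1_card; apply: eq_bigl => -[c' ll]; rewrite !inE /=.
  apply/imsetP/andP => [[ll' + [-> ->]]|[/andP[_ h] /eqP e]].
    by rewrite !inE => ->; rewrite cC eqxx.
  by exists ll; rewrite -e // !inE.
pose g (t : (I * J) * (L * L)) := ((t.1.1, t.2.1), (t.2.2, t.1.2)).
rewrite -(card_imset _ (f := g)); last by move=> [[? ?] [? ?]] [[? ?] [? ?]] [-> -> -> ->].
apply/subset_leq_card/subsetP => _ /imsetP[[[i j] [l l']] + ->].
rewrite !inE /= => /andP[_ /andP[h h']].
by have [-> _ _] := XABC _ _ _ h; have [_ -> _] := XABC _ _ _ h'.
Qed.

End LoomisWhitney.

(** * Progress of one phase on the matrix multiplication DAG *)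

Section MatrixMultiplication.
Variables m1 m2 m3 : nat.
Local Notation G := (mm_dag m1 m2 m3).
Implicit Types (s : state G) (ms : seq (move G)).

Let A i l : G := NodeA m3 i l.
Let B l j : G := NodeB m1 l j.
Let P i l j : G := NodeP i l j.
Let C i j : G := NodeC m2 i j.

Lemma edgeAP i l j : edge (A i l) (P i l j).
Proof. by rewrite /edge /= !eqxx. Qed.

Lemma edgeBP i l j : edge (B l j) (P i l j).
Proof. by rewrite /edge /= !eqxx. Qed.

Lemma edgePC i l j : edge (P i l j) (C i j).
Proof. by rewrite /edge /= !eqxx. Qed.

Lemma source_A i l : is_source (A i l).
Proof. by apply/forallP; case. Qed.

Lemma source_B l j : is_source (B l j).
Proof. by apply/forallP; case. Qed.

Lemma sink_C i j : is_sink (C i j).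
Proof. by apply/forallP; case. Qed.

Lemma injA : injective (fun x : 'I_m1 * 'I_m2 => A x.1 x.2).
Proof. by move=> [? ?] [? ?] /= [-> ->]. Qed.

Lemma injB : injective (fun x : 'I_m2 * 'I_m3 => B x.1 x.2).
Proof. by move=> [? ?] [? ?] /= [-> ->]. Qed.

Lemma injP : injective (fun x : 'I_m1 * 'I_m2 * 'I_m3 => P x.1.1 x.1.2 x.2).
Proof. by move=> [[? ?] ?] [[? ?] ?] /= [-> -> ->]. Qed.

Lemma injC : injective (fun x : 'I_m1 * 'I_m3 => C x.1 x.2).
Proof. by move=> [? ?] [? ?] /= [-> ->]. Qed.

Lemma card_preim_le (T : finType) (f : T -> G) (S : {set G}) :
  injective f -> #|[set x | f x \in S]| <= #|S|.
Proof.
move=> finj; rewrite -(card_imset _ finj); apply/subset_leq_card/subsetP => y.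
by move=> /imsetP[x + ->]; rewrite inE.
Qed.

(** The cardinality serves as a potential: it falls from [m1 * m2 * m3] to 0 over a pebbling, and
    [phase_bound] limits its drop in one phase. *)
Definition untouched s : {set 'I_m1 * 'I_m2 * 'I_m3} :=
  [set t | [&& (A t.1.1 t.1.2, P t.1.1 t.1.2 t.2) \notin marked s,
               (B t.1.2 t.2, P t.1.1 t.1.2 t.2) \notin marked s
             & (P t.1.1 t.1.2 t.2, C t.1.1 t.2) \notin marked s]].

(** The term [r + q] covers the product nodes that end dark or undergo I/O, and [x] the triples
    completed in the phase. The bound on [x] is squared to stay within the naturals. *)
Lemma phase_bound s ms r q : legal_run s ms -> #|red s| <= r ->
  #|dark (run s ms)| <= r -> cost ms <= q ->
  exists x, #|untouched s| <= #|untouched (run s ms)| + (r + q) + x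
            /\ x ^ 2 <= (r + q) ^ 3.
Proof.
move=> leg red_r dark_r cost_q; set s' := run s ms.
have io_q := leq_trans (card_io_nodes ms) cost_q.
pose R := red s :|: io_nodes ms; pose D := dark s' :|: io_nodes ms.
have cR : #|R| <= r + q by apply: leq_trans (leq_card_setU _ _) (leq_add _ _).
have cD : #|D| <= r + q by apply: leq_trans (leq_card_setU _ _) (leq_add _ _).
pose A0 := [set x | A x.1 x.2 \in R].
pose B0 := [set x | B x.1 x.2 \in R].
pose C0 := [set x | C x.1 x.2 \in D].
pose P0 := [set x | P x.1.1 x.1.2 x.2 \in D].
pose X := [set t : 'I_m1 * 'I_m2 * 'I_m3 |
  [&& (t.1.1, t.1.2) \in A0, (t.1.2, t.2) \in B0 & (t.1.1, t.2) \in C0]].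
exists #|X|; split; last first.
  have le := @loomis_whitney _ _ _ X A0 B0 C0.
  apply: leq_trans (le _) _; first by move=> i l j; rewrite inE => /and3P[].
  rewrite !expnS expn0 muln1 mulnA; apply: leq_mul; first apply: leq_mul.
  - exact: leq_trans (card_preim_le _ injA) cR.
  - exact: leq_trans (card_preim_le _ injB) cR.
  - exact: leq_trans (card_preim_le _ injC) cD.
have cP0 : #|P0| <= r + q by apply: leq_trans (card_preim_le _ injP) cD.
suff sub : untouched s \subset untouched s' :|: P0 :|: X.
  apply: leq_trans (subset_leq_card sub) _.
  apply: leq_trans (leq_card_setU _ _) _; rewrite leq_add2r.
  by apply: leq_trans (leq_card_setU _ _) _; rewrite leq_add2l.
apply/subsetP => -[[i l] j] ut; rewrite !in_setU -orbA.
have [//|t'] /= := boolP (_ \in untouched s').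
move: ut; rewrite inE /= => /and3P[aN bN cN].
have inP : (P i l j, C i j) \in marked s' ->
    (A i l, P i l j) \in marked s' /\ (B l j, P i l j) \in marked s'.
  move=> cM; have /forallP inm := tail_marked leg cN cM.
  by split; [move: (inm (A i l)); rewrite edgeAP | move: (inm (B l j)); rewrite edgeBP].
(* Whichever edge of the triple got marked, an edge into its product was marked in this phase, so
   [head_marked] applies. *)
have : (P i l j \in D) || (~~ is_sink (P i l j) && all_out_marked s' (P i l j)).
  move: t'; rewrite inE /= !negb_and !negbK => /or3P[aM|bM|/inP[aM _]].
  - exact: head_marked leg aN aM.
  - exact: head_marked leg bN bM.
  - exact: head_marked leg aN aM.
(* Outside [D], the product has all three edges marked within the phase, which puts its two sources
   in [R] and its sink in [D]. *)
case/orP=> [PD|/andP[_ /forallP outm]]; first by rewrite inE PD.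
have cM : (P i l j, C i j) \in marked s' by move: (outm (C i j)); rewrite edgePC.
have [aM bM] := inP cM.
apply/orP; right; rewrite !inE /=; apply/and3P; split.
- by move: (source_used leg (source_A i l) aN aM); rewrite !inE.
- by move: (source_used leg (source_B l j) bN bM); rewrite !inE.
(* A sink cannot lose its dark pebble by deletion. *)
- by move: (head_marked leg cN cM); rewrite sink_C orbF !inE.
Qed.

Lemma untouched_initial : #|untouched (initial G)| = m1 * m2 * m3.
Proof.
have -> : untouched (initial G) = setT by apply/setP => t; rewrite !inE.
by rewrite cardsT !card_prod !card_ord.
Qed.

Lemma untouched_terminal s : terminal s -> untouched s = set0.
Proof.
case/andP=> _ /forallP full; apply/setP => -[[i l] j]; rewrite !inE /=.
by move: (full (A i l)) => /forallP/(_ (P i l j)); rewrite edgeAP /= => ->.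
Qed.

(** The cost is at least the number of [A] nodes, of [B] nodes and of [C] nodes; these three numbers
    multiply to the square on the left. *)
Lemma small_cost_bound r ms : 0 < m1 -> 0 < m2 -> 0 < m3 ->
  pebbling r ms -> (m1 * m2 * m3) ^ 2 <= cost ms ^ 3.
Proof.
move=> p1 p2 p3 val.
have leg : legal_run (initial G) ms.
  by have [|] := @valid_from_cat _ r (initial G) ms [::]; rewrite ?cats0.
have /andP[/forallP sinks /forallP full] := valid_terminal val.
(* Nonempty index sets give each source an outgoing edge and each sink an incoming one. *)
pose i0 := Ordinal p1; pose l0 := Ordinal p2; pose j0 := Ordinal p3.
have io_source u v : is_source u -> edge u v -> u \in io_nodes ms.
  move=> su uv; have uvM : (u, v) \in marked (run (initial G) ms).
    by move: (full u) => /forallP/(_ v); rewrite uv.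
  have := source_used leg su _ uvM; rewrite !inE /=; exact.
have all_io (T : finType) (f : T -> G) : injective f ->
    (forall x, f x \in io_nodes ms) -> #|T| <= cost ms.
  move=> finj fio; apply: leq_trans (card_io_nodes ms); rewrite -cardsT.
  apply: leq_trans (card_preim_le (io_nodes ms) finj).
  by apply/subset_leq_card/subsetP => x _; rewrite inE.
have cA : m1 * m2 <= cost ms.
  have -> : m1 * m2 = #|{: 'I_m1 * 'I_m2}| by rewrite card_prod !card_ord.
  apply: all_io injA _ => -[i l].
  exact: io_source (source_A i l) (edgeAP i l j0).
have cB : m2 * m3 <= cost ms.
  have -> : m2 * m3 = #|{: 'I_m2 * 'I_m3}| by rewrite card_prod !card_ord.
  apply: all_io injB _ => -[l j].
  exact: io_source (source_B l j) (edgeBP i0 l j).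
have cC : m1 * m3 <= cost ms.
  have -> : m1 * m3 = #|{: 'I_m1 * 'I_m3}| by rewrite card_prod !card_ord.
  apply: all_io injC _ => -[i j].
  have := subsetP (blue_run (initial G) ms) (C i j).
  move: (sinks (C i j)); rewrite sink_C /= => -> /(_ isT); rewrite !inE.
  case/orP=> // /forallP/(_ (P i l0 j)); by rewrite edgePC.
have -> : (m1 * m2 * m3) ^ 2 = (m1 * m2) * (m2 * m3) * (m1 * m3) by ring.
by rewrite !expnS expn0 muln1 [leqRHS]mulnA; apply: leq_mul => //; apply: leq_mul.
Qed.

(** * Summation over the phases, with real constants *)

Local Open Scope ring_scope.

(** As [r] is at least 1, [r + r] is at most twice [r * sqrt r]; and [x] is at most three times it,
    because 8 is at most [3 ^ 2]. Hence the 5. *)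
Lemma phase_bound_sqrt (R : realType) (r x y z : nat) : (0 < r)%N ->
  (y <= z + (r + r) + x)%N -> (x ^ 2 <= (r + r) ^ 3)%N ->
  y%:R <= z%:R + 5 * r%:R * Num.sqrt r%:R :> R.
Proof.
move=> r0 yle xle.
set q := Num.sqrt _.
have r1 : 1 <= r%:R :> R by rewrite ler1n.
have qq : q ^+ 2 = r%:R by rewrite sqr_sqrtr ?ler0n.
have q0 : 0 <= q by rewrite sqrtr_ge0.
have q1 : 1 <= q by rewrite -(@ler_pXn2r _ 2) ?nnegrE // expr1n qq.
have xq : x%:R <= 3 * r%:R * q.
  rewrite -(@ler_pXn2r _ 2) ?nnegrE ?ler0n ?mulr_ge0 ?ler0n //.
  rewrite !exprMn qq -natrX.
  apply: le_trans (_ : ((r + r) ^ 3)%N%:R <= _); first by rewrite ler_nat.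
  rewrite natrX natrD.
  have -> : (r%:R + r%:R) ^+ 3 = 8 * r%:R ^+ 3 :> R by ring.
  have -> : 3 ^+ 2 * r%:R ^+ 2 * r%:R = 9 * r%:R ^+ 3 :> R by ring.
  by rewrite ler_wpM2r ?exprn_ge0 ?ler_nat.
have : y%:R <= z%:R + (r%:R + r%:R) + x%:R :> R by rewrite -!natrD ler_nat.
have : r%:R <= r%:R * q by rewrite ler_peMr.
nra.
Qed.

(** A phase of cost exactly [r] is charged [5 * sqrt r] per I/O move; the summand [r] pays for the
    last phase, which may be cheaper. The starting state is arbitrary so that the induction can
    resume after a phase. *)
Lemma phases_bound (R : realType) (r : nat) s ms : (0 < r)%N ->
  valid_from r s ms ->
  #|untouched s|%:R <= 5 * Num.sqrt r%:R * ((cost ms)%:R + r%:R) :> R.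
Proof.
move=> r0; have [n] := ubnP (cost ms); elim: n s ms => // n IH s ms ltn val.
have red_le s1 : (num_red s1 <= r)%N -> (#|red s1| <= r /\ #|dark s1| <= r)%N.
  by move=> le; split; apply: leq_trans le; rewrite ?leq_card_setU ?leq_addl.
have [red_s _] := red_le _ (valid_num_red val).
have q0 : 0 <= Num.sqrt r%:R :> R by rewrite sqrtr_ge0.
have phase ms1 ms2 : ms = ms1 ++ ms2 -> (cost ms1 <= r)%N ->
    valid_from r (run s ms1) ms2 /\ #|untouched s|%:R
      <= #|untouched (run s ms1)|%:R + 5 * r%:R * Num.sqrt r%:R :> R.
  move=> e cr; move: val; rewrite e => /valid_from_cat[leg val2]; split=> //.
  have [_ dark_s] := red_le _ (valid_num_red val2).
  have [x [le1 le2]] := phase_bound leg red_s dark_s cr.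
  exact: phase_bound_sqrt r0 le1 le2.
have [le|/ltnW ge] := leqP (cost ms) r.
  have [|_] := phase ms [::] _ le; first by rewrite cats0.
  rewrite (untouched_terminal (valid_terminal val)) cards0.
  have : 0 <= Num.sqrt r%:R * (cost ms)%:R :> R by rewrite mulr_ge0.
  nra.
have [ms1 [ms2 [e c1]]] := split_cost ge.
have [|val2 le] := phase ms1 ms2 e; first by rewrite c1.
have ec : cost ms = (r + cost ms2)%N by rewrite e cost_cat c1.
have lt2 : (cost ms2 < n)%N by lia.
apply: le_trans le _; have := IH _ _ lt2 val2; rewrite ec natrD; nra.
Qed.

Lemma pebbling_cost_bound (R : realType) (r : nat) ms :
  (0 < m1)%N -> (0 < m2)%N -> (0 < m3)%N -> (0 < r)%N -> pebbling r ms ->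
  (m1 * m2 * m3)%N%:R <= 10 * Num.sqrt r%:R * (cost ms)%:R :> R.
Proof.
move=> p1 p2 p3 r0 val.
have q0 : 0 <= Num.sqrt r%:R :> R by rewrite sqrtr_ge0.
(* If the cost is at least [r], absorbing the summand [r] into it doubles the constant 5. *)
have [le|/ltnW ge] := leqP r (cost ms).
  rewrite -untouched_initial; apply: le_trans (phases_bound R r0 val) _.
  have : r%:R <= (cost ms)%:R :> R by rewrite ler_nat.
  nra.
have k0 : 0 <= (cost ms)%:R :> R by [].
(* For a cost below [r], its cube is at most [r] times its square, so the bound holds even with
   constant 1. *)
apply: (@le_trans _ _ (Num.sqrt r%:R * (cost ms)%:R)); last first.
  by have := mulr_ge0 q0 k0; nra.
rewrite -(@ler_pXn2r _ 2) ?nnegrE ?mulr_ge0 // exprMn sqr_sqrtr //.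
rewrite -!natrX -natrM ler_nat.
apply: leq_trans (small_cost_bound p1 p2 p3 val) _.
by rewrite expnS leq_mul2r ge orbT.
Qed.

End MatrixMultiplication.

(** * From single pebblings to the optimum *)

Local Open Scope ring_scope.

Theorem theorem6p10 (R : realType) :
  exists c : R, 0 < c /\
    forall m1 m2 m3 r : nat,
      (0 < m1)%N -> (0 < m2)%N -> (0 < m3)%N -> (2 <= r)%N ->
      c * ((m1 * m2 * m3)%N%:R / Num.sqrt r%:R)
        <= (OPT_PRBP (mm_dag m1 m2 m3) r)%:R.
Proof.
exists 10^-1; split=> [|m1 m2 m3 r p1 p2 p3 r2]; first by rewrite invr_gt0.
have r0 : (0 < r)%N := ltnW r2.
(* The branch with the dummy value 0 is contradictory, since a pebbling exists. *)
rewrite /OPT_PRBP; case: pselect => [ex|[]]; last first.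
  have [ms val] := pebbling_exists (mm_dag m1 m2 m3) r2.
  by exists (cost ms); apply/asboolP; exists ms.
(* The minimum is the cost of an actual pebbling [ms]. *)
case: ex_minnP => _ /asboolP[ms [val <-]] _.
have q0 : 0 < Num.sqrt r%:R :> R by rewrite sqrtr_gt0 ltr0n.
rewrite mulrA ler_pdivrMr // ler_pdivrMl //.
by rewrite [_%:R * Num.sqrt _]mulrC mulrA; apply: pebbling_cost_bound.
Qed.
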